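(* Let $n\geqslant4$ be an integer and let $\alpha,\beta$ be real numbers satisfying one of: $-1<\alpha<0,\ -1<\beta$; or $0\leqslant\alpha<1,\ 0<\beta$; or $1\leqslant\alpha<2,\ 1<\beta$. Then the zeros of the polynomials $\phi_n^{(\alpha,\beta)}(\mu)$ and $\phi_{n-1}^{(\alpha,\beta)}(\mu)$ interlace (strictly).
   Context: For real $a$ and integer $m\geqslant0$, $(a)_m=a(a+1)\cdots(a+m-1)$, $(a)_0=1$. The Jacobi polynomial is $P_n^{(\alpha,\beta)}(x)=\frac{(\alpha+1)_n}{n!}\sum_{k=0}^{n}\frac{(-n)_k(n+\alpha+\beta+1)_k}{k!\,(\alpha+1)_k}\big(\frac{1-x}{2}\big)^k$, and $$\phi_n^{(\alpha,\beta)}(\mu)=\sum_{k=0}^{[n/2]}\Big(\tfrac{d^{2k}}{dx^{2k}}P_n^{(\alpha,\beta)}(x)\Big)\Big|_{x=1}\mu^k=\frac{(\alpha+1)_n}{n!}\sum_{k=0}^{[n/2]}\frac{(-n)_{2k}(n+\alpha+\beta+1)_{2k}}{(\alpha+1)_{2k}}\Big(\frac{\mu}{4}\Big)^k .$$ Two real polynomials interlace (strictly) if all their zeros are real, simple and mutually distinct, and between any two consecutive zeros of either polynomial there is exactly one zero of the other. *)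

(* Defs.v *)
From HB Require Import structures.
From mathcomp Require Import all_boot all_order all_algebra.
Set Implicit Arguments. Unset Strict Implicit. Unset Printing Implicit Defensive.
Import Order.TTheory GRing.Theory Num.Theory.
Local Open Scope ring_scope.

Definition poch (R : pzRingType) (a : R) (m : nat) : R :=
  \prod_(i < m) (a + i%:R).

Definition jacobiP (R : fieldType) (n : nat) (al be : R) : {poly R} :=
  (poch (al + 1) n / (n`!)%:R) *:
  \sum_(k < n.+1)
     ((poch (- (n%:R)) k * poch (n%:R + al + be + 1) k
        / ((k`!)%:R * poch (al + 1) k))
      *: (((1 - 'X) * (2%:R)^-1%:P) ^+ k)).

Definition phi (R : fieldType) (n : nat) (al be : R) : {poly R} :=
  \sum_(k < n./2.+1) ((jacobiP n al be)^`(2 * k)).[1] *: 'X^k.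

(* Strict interlacing of the zeros of two real polynomials: both are nonzero,
   all zeros are real and simple (each polynomial is its leading coefficient
   times the product over a strictly increasing list of its roots), the two
   zero sets are disjoint, and between two consecutive zeros of either
   polynomial there is exactly one zero of the other. *)
Definition interlace (R : realDomainType) (p q : {poly R}) : Prop :=
  exists (rp rq : seq R),
    p != 0 /\ q != 0 /\
    sorted <%R rp /\ sorted <%R rq /\
    p = lead_coef p *: \prod_(r <- rp) ('X - r%:P) /\
    q = lead_coef q *: \prod_(r <- rq) ('X - r%:P) /\
    (forall x, x \in rp -> x \notin rq) /\
        (forall i, (i.+1 < size rp)%N ->
            count (fun y => (rp`_i < y) && (y < rp`_i.+1)) rq = 1%N) /\
        (forall i, (i.+1 < size rq)%N ->
            count (fun y => (rq`_i < y) && (y < rq`_i.+1)) rp = 1%N).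

(* Main.v *)
Require Import Defs.
From HB Require Import structures.
From mathcomp Require Import all_boot all_order all_algebra.
From mathcomp Require Import polyrcf ring lra zify.
Set Implicit Arguments. Unset Strict Implicit. Unset Printing Implicit Defensive.
Import Order.TTheory GRing.Theory Num.Theory.
Local Open Scope ring_scope.

(** Write F_n(z) = sum_j z^j P_n^(j)(1) = E_n(z^2) + z O_n(z^2). Then E_n is
    phi_n^(al,be) and, because P_n' is a multiple of P_(n-1)^(al+1,be+1), O_n is a
    multiple of phi_(n-1)^(al+1,be+1).

    The heart of the matter is that Im (F_(n+1) / F_n) > 0 on the positive
    imaginary axis, i.e. O_(n+1) E_n - E_(n+1) O_n > 0 on (-oo, 0), if
    -1 < al < 1 and be > 0. The polynomial
    h(x) = sum_j z^j (F_n(z) P_(n+1)^(j)(x) - F_(n+1)(z) P_n^(j)(x)) vanishes at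
    x = 1 and satisfies h - z h' = F_n(z) P_(n+1) - F_(n+1)(z) P_n. Pairing this
    equation with the conjugate of h / (1 - x) in the Jacobi inner product,
    orthogonality turns one side into a positive multiple of that imaginary part,
    and integration by parts turns the other one into a positive definite form.
    Pairing with the conjugate of h instead gives Re (F_(n+1) / F_n) > 0 if
    -1 < al <= 0 and be > 0. Since P_n^(al,be-1) is a positive combination of
    P_n^(al,be) and P_(n-1)^(al,be), both facts together extend the first one to
    -1 < al < 0, be > -1.

    Positivity of the cross terms for all n yields, by counting sign changes and
    induction on n, the interlacing of E_n and O_n, of E_(n+1) and E_n, and of
    O_(n+1) and O_n. The third case is the statement on the O_n for the
    parameters (al - 1, be - 1). *)

(** * Jacobi polynomials and the Jacobi functional *)

Section Jacobi.
Variable R : realFieldType.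
Implicit Types (a b c m x : R) (p q r : {poly R}) (n k : nat).

Lemma poch0 x : poch x 0 = 1. Proof. exact: big_ord0. Qed.

Lemma pochSr x k : poch x k.+1 = poch x k * (x + k%:R).
Proof. by rewrite /poch big_ord_recr. Qed.

Lemma pochSl x k : poch x k.+1 = x * poch (x + 1) k.
Proof.
rewrite /poch big_ord_recl addr0; congr (_ * _).
by apply: eq_bigr => i _; rewrite lift0 -natr1; ring.
Qed.

Lemma poch_gt0 x k : 0 < x -> 0 < poch x k.
Proof. by move=> x0; apply: prodr_gt0 => i _; rewrite ltr_wpDr ?ler0n. Qed.

Lemma poch_shift x k : x != 0 -> poch (x + 1) k = poch x k * (x + k%:R) / x.
Proof. by move=> x0; rewrite -pochSr pochSl mulrAC mulfV ?mul1r. Qed.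

(** The Jacobi polynomial normalized to 1 at x = 1, in the variable s = (x - 1) / 2: the series
    2F1(-n, n+a+b+1; a+1; -s). In this variable its coefficients are positive and the evaluation
    point is 0. *)
Definition jac a b n : {poly R} :=
  \poly_(k < n.+1) ('C(n, k)%:R * poch (n%:R + a + b + 1) k / poch (a + 1) k).

Lemma coef_jac a b n k :
  (jac a b n)`_k = 'C(n, k)%:R * poch (n%:R + a + b + 1) k / poch (a + 1) k.
Proof.
rewrite coef_poly; case: ltnP => // nk.
by rewrite bin_small // !mul0r.
Qed.

Lemma jac0 a b : jac a b 0 = 1.
Proof.
apply/polyP=> -[|k]; rewrite coef_jac coefC; first by rewrite !poch0 bin0 !mul1r invr1.
by rewrite bin_small ?mul0r.
Qed.

Lemma coef_jac_gt0 a b n k :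
  -1 < a -> -1 < b -> (k <= n)%N -> 0 < (jac a b n)`_k.
Proof.
move=> ha hb; rewrite coef_jac; case: n k => [|n] [|k] // kn.
(* Degree 0 is treated apart: a + b + 1 may be nonpositive there, but only k = 0 occurs. *)
- by rewrite !poch0 bin0 !mul1r invr1.
- by rewrite !poch0 bin0 !mul1r invr1.
- have n0 : 0 <= n%:R :> R by rewrite ler0n.
  rewrite divr_gt0 ?mulr_gt0 ?poch_gt0 ?ltr0n ?bin_gt0 //; last lra.
  by rewrite -natr1; lra.
Qed.

Lemma size_jac a b n : -1 < a -> -1 < b -> size (jac a b n) = n.+1.
Proof.
move=> ha hb; apply/eqP; rewrite eqn_leq size_poly /= ltnNge.
apply/negP => /leq_sizeP/(_ n (leqnn n)).
by move/eqP; rewrite gt_eqF // coef_jac_gt0.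
Qed.

Lemma deriv_jac a b n : -1 < a ->
  (jac a b n.+1)^`() =
  (n.+1%:R * (n.+1%:R + a + b + 1) / (a + 1)) *: jac (a + 1) (b + 1) n.
Proof.
move=> ha; have a0 : a + 1 != 0 by apply/lt0r_neq0; lra.
have p0 k : poch (a + 1 + 1) k != 0 by apply/lt0r_neq0/poch_gt0; lra.
apply/polyP=> k; rewrite coef_deriv coefZ !coef_jac -mulr_natl !pochSl.
have -> : n.+1%:R + a + b + 1 + 1 = n%:R + (a + 1) + (b + 1) + 1 :> R.
  by rewrite -natr1; ring.
have k0 : k.+1%:R != 0 :> R by rewrite pnatr_eq0.
have -> : 'C(n.+1, k.+1)%:R = n.+1%:R * 'C(n, k)%:R / k.+1%:R :> R.
  by rewrite -natrM (mul_bin_diag n.+1 k) natrM mulrAC mulfV ?mul1r.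
by field; rewrite a0 p0 nat1r k0.
Qed.

(** The beta integral of s^k (-s)^a (1+s)^b over [-1, 0], divided by the total mass. *)
Definition mom a b k : R := (-1) ^+ k * poch (a + 1) k / poch (a + b + 2) k.

(* The normalized Jacobi functional in the variable s = (x - 1) / 2, that is
   integration against (-s)^a (1+s)^b on [-1, 0]. *)
Definition jint a b q : R := \sum_(k < size q) q`_k * mom a b k.

Lemma jintE a b q N : (size q <= N)%N -> jint a b q = \sum_(k < N) q`_k * mom a b k.
Proof.
move=> qN; rewrite /jint (big_ord_widen _ (fun k => q`_k * mom a b k) qN) big_mkcond /=.
apply: eq_bigr => k _; case: ltnP => // qk; by rewrite nth_default ?mul0r.
Qed.

Lemma jint_is_linear a b : linear_for *%R (jint a b).
Proof.
move=> c p q; set N := maxn (size p) (size q).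
have h1 : (size (c *: p + q)%R <= N)%N.
  by rewrite (leq_trans (size_polyD _ _)) // geq_max leq_maxr (leq_trans (size_scale_leq _ _)) ?leq_maxl.
rewrite (jintE _ _ h1) (jintE _ _ (leq_maxl (size p) (size q))).
rewrite (jintE _ _ (leq_maxr (size p) (size q))) mulr_sumr -big_split /=.
by apply: eq_bigr => k _; rewrite coefD coefZ; ring.
Qed.

HB.instance Definition _ a b :=
  GRing.isLinear.Build R {poly R} R *%R (jint a b) (jint_is_linear a b).

Lemma jintXn a b k : jint a b 'X^k = mom a b k.
Proof.
rewrite /jint size_polyXn big_ord_recr /= coefXn eqxx mul1r big1 ?add0r // => i _.
by rewrite coefXn ltn_eqF ?mul0r.
Qed.

Lemma linear_forP (f : {poly R} -> R) : linear_for *%R f ->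
  forall p, f p = \sum_(k < size p) p`_k * f 'X^k.
Proof.
move=> lf p; have f0 : f 0 = 0.
  by have := lf (-1) 0 0; rewrite scaler0 addr0 mulN1r addNr.
rewrite -[in LHS](coefK p) poly_def.
elim/big_rec2: _ => [//|k x q _ IH].
by rewrite lf IH.
Qed.

(** Replaces integration: identities between functionals are checked on monomials, where they become
    identities between moments. *)
Lemma linear_for_ext (f g : {poly R} -> R) :
  linear_for *%R f -> linear_for *%R g ->
  (forall k, f 'X^k = g 'X^k) -> f =1 g.
Proof.
move=> lf lg fg p; rewrite (linear_forP lf) (linear_forP lg).
by apply: eq_bigr => k _; rewrite fg.
Qed.

Lemma momS a b k : -1 < a -> -1 < b ->
  mom a b k.+1 = - mom a b k * (a + 1 + k%:R) / (a + b + 2 + k%:R).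
Proof.
move=> ha hb; rewrite /mom !pochSr exprS.
have : 0 < poch (a + b + 2) k by apply: poch_gt0; lra.
have k0 : 0 <= k%:R :> R := ler0n _ k.
have : 0 < a + b + 2 + k%:R by lra.
by move=> /lt0r_neq0 h1 /lt0r_neq0 h2; field; rewrite h1 h2.
Qed.

(** The factor -s is absorbed by the weight; the constant is the ratio of the two total masses. *)
Lemma jint_mulNX a b q : -1 < a -> -1 < b ->
  jint a b (- 'X * q) = (a + 1) / (a + b + 2) * jint (a + 1) b q.
Proof.
move=> ha hb; move: q; apply: linear_for_ext.
- by move=> c p q; rewrite -linearP; congr jint; rewrite -!mul_polyC; ring.
- by move=> c p q; rewrite linearP /=; ring.
move=> k; have -> : - 'X * 'X^k = -1 *: 'X^(k.+1) :> {poly R}.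
  by rewrite scaleN1r exprS mulNr.
rewrite linearZ /= !jintXn momS // /mom.
have -> : a + 1 + b + 2 = a + b + 2 + 1 by ring.
have k0 : 0 <= k%:R :> R := ler0n _ k.
have h0 : poch (a + b + 2) k != 0 by apply/lt0r_neq0/poch_gt0; lra.
have h1 : a + 1 != 0 by apply/lt0r_neq0; lra.
have h2 : a + b + 2 != 0 by apply/lt0r_neq0; lra.
have h3 : a + b + 2 + k%:R != 0 by apply/lt0r_neq0; lra.
by rewrite (poch_shift k h1) (poch_shift k h2); field; rewrite h0 h1 h2 h3.
Qed.

Lemma jint_mul1DX a b q : -1 < a -> -1 < b ->
  jint a b ((1 + 'X) * q) = (b + 1) / (a + b + 2) * jint a (b + 1) q.
Proof.
move=> ha hb; move: q; apply: linear_for_ext.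
- by move=> c p q; rewrite -linearP; congr jint; rewrite -!mul_polyC; ring.
- by move=> c p q; rewrite linearP /=; ring.
move=> k; have -> : (1 + 'X) * 'X^k = 'X^k + 'X^(k.+1) :> {poly R}.
  by rewrite mulrDl mul1r -exprS.
rewrite linearD /= !jintXn momS // /mom.
have -> : a + (b + 1) + 2 = a + b + 2 + 1 by ring.
have k0 : 0 <= k%:R :> R := ler0n _ k.
have h0 : poch (a + b + 2) k != 0 by apply/lt0r_neq0/poch_gt0; lra.
have h2 : a + b + 2 != 0 by apply/lt0r_neq0; lra.
have h3 : a + b + 2 + k%:R != 0 by apply/lt0r_neq0; lra.
by rewrite (poch_shift k h2); field; rewrite h0 h2 h3.
Qed.

(** The left integrand is, up to sign, (1+s)^b times the derivative of (-s)^(a+1) q. For b > 0 the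
    boundary terms vanish and the derivative falls on (1+s)^b. *)
Lemma jint_by_parts a b q : -1 < a -> 0 < b ->
  jint a b ((a + 1) *: q + 'X * q^`()) = (a + 1) * jint (a + 1) (b - 1) q.
Proof.
move=> ha hb; move: q; apply: linear_for_ext.
- move=> c p q; rewrite -linearP; congr jint.
  by rewrite derivD derivZ -!mul_polyC; ring.
- by move=> c p q; rewrite linearP /=; ring.
move=> k; have -> : (a + 1) *: 'X^k + 'X * ('X^k)^`() = (a + 1 + k%:R) *: 'X^k :> {poly R}.
  rewrite derivXn mulrnAr [RHS]scalerDl scaler_nat; congr (_ + _).
  by case: k => // k; rewrite -exprS.
rewrite linearZ /= !jintXn /mom.
have -> : a + 1 + (b - 1) + 2 = a + b + 2 by ring.
have h1 : a + 1 != 0 by apply/lt0r_neq0; lra.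
have h0 : poch (a + b + 2) k != 0 by apply/lt0r_neq0/poch_gt0; lra.
by rewrite (poch_shift k h1); field; rewrite h0 h1.
Qed.

(** Times the weight, the argument is up to sign the derivative of (-s)^(a+1) (1+s)^(b+1) q, which
    vanishes at both ends. *)
Lemma jint_pearson a b q : -1 < a -> -1 < b ->
  jint a b ('X * (1 + 'X) * q^`() + ((a + 1) *: (1 + 'X) + (b + 1) *: 'X) * q) = 0.
Proof.
move=> ha hb; have -> : 'X * (1 + 'X) * q^`() + ((a + 1) *: (1 + 'X) + (b + 1) *: 'X) * q
  = (1 + 'X) * ((a + 1) *: q + 'X * q^`()) - (b + 1) *: (- 'X * q).
  by rewrite -!mul_polyC; ring.
rewrite linearB /= jint_mul1DX // jint_by_parts //; last lra.
rewrite linearZ /= jint_mulNX //; have -> : b + 1 - 1 = b by ring.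
by ring.
Qed.

(** * Differential equation, orthogonality and positivity of the functional *)

Lemma natr_bin_left n k :
  k.+1%:R * 'C(n, k.+1)%:R = (n%:R - k%:R) * 'C(n, k)%:R :> R.
Proof.
rewrite -natrM mul_bin_left natrM; have [kn|nk] := leqP k n; first by rewrite natrB.
by rewrite bin_small // !mulr0.
Qed.

(** The hypergeometric equation; on coefficients it is the two-term recurrence [rec]. *)
Lemma jac_ode a b n : -1 < a ->
  'X * (1 + 'X) * (jac a b n)^`()^`() + ((a + 1) *: (1 + 'X) + (b + 1) *: 'X) * (jac a b n)^`()
  = (n%:R * (n%:R + a + b + 1)) *: jac a b n.
Proof.
move=> ha; set p := jac a b n.
have rec k : (k.+1%:R * (a + 1 + k%:R)) * p`_k.+1 =
             (n%:R - k%:R) * (n%:R + a + b + 1 + k%:R) * p`_k.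
  rewrite !coef_jac !pochSr.
  have k0 : 0 <= k%:R :> R := ler0n _ k.
  have h0 : poch (a + 1) k != 0 by apply/lt0r_neq0/poch_gt0; lra.
  have h1 : a + 1 + k%:R != 0 by apply/lt0r_neq0; lra.
  rewrite -!mulrA [k.+1%:R * _]mulrCA [X in _ * X]mulrA natr_bin_left.
  by field; rewrite h0 h1.
have -> : 'X * (1 + 'X) * p^`()^`() + ((a + 1) *: (1 + 'X) + (b + 1) *: 'X) * p^`()
  = 'X * p^`()^`() + 'X * ('X * p^`()^`()) + (a + 1) *: p^`() + (a + b + 2) *: ('X * p^`()).
  by rewrite -!mul_polyC; ring.
apply/polyP => k; rewrite !coefD !coefZ !coefXM.
case: k => [|k] /=.
  by have := rec 0; rewrite !coef_deriv !mulr0n mul1r !mulr1n; lra.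
rewrite !coef_deriv; transitivity (k.+2%:R * (a + 1 + k.+1%:R) * p`_k.+2
    + k.+1%:R * (k.+1%:R + a + b + 1) * p`_k.+1); last by rewrite rec; ring.
by case: k => [|k] /=; rewrite ?coef_deriv; ring.
Qed.

(** The differential equation in self-adjoint form writes the polynomial as a derivative;
    integrating by parts moves one derivative onto q and raises both parameters. *)
Lemma jint_jacS a b n q : -1 < a -> -1 < b ->
  jint a b (jac a b n.+1 * q) =
  (b + 1) / ((a + b + 2) * (a + b + 3)) *
    jint (a + 1) (b + 1) (jac (a + 1) (b + 1) n * q^`()).
Proof.
move=> ha hb; set p := jac a b n.+1; set l := n.+1%:R * (n.+1%:R + a + b + 1).
have n0 : 0 <= n%:R :> R := ler0n _ n.
have l0 : l != 0.
  by apply/lt0r_neq0; rewrite mulr_gt0 ?ltr0n // -natr1; move: n0 ha hb; clear; lra.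
apply: (mulfI l0); rewrite -[LHS]linearZ scalerAl -jac_ode // -/p.
have -> : ('X * (1 + 'X) * p^`()^`() + ((a + 1) *: (1 + 'X) + (b + 1) *: 'X) * p^`()) * q
  = ('X * (1 + 'X) * (p^`() * q)^`() + ((a + 1) *: (1 + 'X) + (b + 1) *: 'X) * (p^`() * q))
    + - 'X * ((1 + 'X) * (p^`() * q^`())).
  by rewrite derivM -!mul_polyC; ring.
rewrite linearD /= jint_pearson // add0r jint_mulNX // jint_mul1DX //; last lra.
rewrite /p deriv_jac // -scalerAl linearZ /= -/l.
have h1 : a + b + 2 != 0 by apply/lt0r_neq0; lra.
have h3 : a + b + 3 != 0 by apply/lt0r_neq0; lra.
have h4 : a + 1 != 0 by apply/lt0r_neq0; lra.
have -> : a + 1 + b + 2 = a + b + 3 by ring.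
by rewrite /l; field; rewrite h1 h3 h4.
Qed.

(** Applying [jint_jacS] n times leaves the n-th derivative of q, a constant under the size bound.
    This gives orthogonality to lower degrees together with the sign of the top pairing. *)
Lemma jint_jac a b n : -1 < a -> -1 < b ->
  exists2 K, 0 < K &
    forall q, (size q <= n.+1)%N -> jint a b (jac a b n * q) = K * q`_n.
Proof.
elim: n a b => [|n IH] a b ha hb.
  exists 1 => // q /size1_polyC ->; rewrite jac0 !mul1r coefC /= -alg_polyC linearZ /=.
  by rewrite -(expr0 'X) jintXn /mom !poch0 invr1 !mulr1.
have [||K K0 hK] := IH (a + 1) (b + 1); [lra|lra|].
exists ((b + 1) / ((a + b + 2) * (a + b + 3)) * K * n.+1%:R).
  by rewrite !mulr_gt0 ?invr_gt0 ?mulr_gt0 ?ltr0n //; lra.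
move=> q qn; rewrite jint_jacS // hK; last first.
  by apply/leq_sizeP => j nj; rewrite coef_deriv nth_default ?mul0rn // (leq_trans qn).
by rewrite coef_deriv -mulr_natl; ring.
Qed.

(** Induction on the size: subtracting the multiple of [jac] with the same top coefficient leaves a
    remainder of lower degree, and orthogonality kills the mixed term. *)
Lemma jint_sqr_gt0 a b q : -1 < a -> -1 < b -> q != 0 -> 0 < jint a b (q * q).
Proof.
move=> ha hb; have [n] := ubnP (size q); elim: n q => // n IH q qn q0.
case: n => [|n] in IH qn *.
  by move: q0; rewrite -size_poly_gt0; lia.
have [sq|sq] := ltnP (size q) n.+1; first exact: IH.
have {}sq : size q = n.+1 by lia.
have [K K0 hK] := jint_jac n ha hb.
have l0 := coef_jac_gt0 ha hb (leqnn n); have sj := size_jac n ha hb.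
set p := jac a b n in hK l0 sj *; set c := q`_n / p`_n; set r := q - c *: p.
have rn : (size r <= n)%N.
  apply/leq_sizeP => j; rewrite leq_eqVlt => /orP[/eqP<-|nj].
    by rewrite coefB coefZ divfK ?subrr // gt_eqF.
  by rewrite coefB coefZ !nth_default ?mulr0 ?subr0 // ?sq ?sj.
have -> : q * q = (c * c) *: (p * p) + (2 * c) *: (p * r) + r * r.
  by rewrite /r -!mul_polyC; ring.
rewrite !linearD !linearZ /= !hK; last 2 first.
- exact: leq_trans rn _.
- by rewrite sj.
have r_n : r`_n = 0 by rewrite nth_default.
rewrite r_n !mulr0 addr0.
have c0 : c != 0.
  by rewrite mulf_neq0 ?invr_eq0 ?(gt_eqF l0) // -[n]/(n.+1.-1) -sq -lead_coefE lead_coef_eq0.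
have cc : 0 < c * c by rewrite -expr2 exprn_even_gt0.
rewrite ltr_pwDl //; first by rewrite (mulr_gt0 cc) // mulr_gt0.
have [->|rN0] := eqVneq r 0; first by rewrite mulr0 linear0.
by rewrite ltW // IH.
Qed.

Lemma jint_sqr_ge0 a b q : -1 < a -> -1 < b -> 0 <= jint a b (q * q).
Proof.
move=> ha hb; have [->|q0] := eqVneq q 0; first by rewrite mulr0 linear0.
by rewrite ltW // jint_sqr_gt0.
Qed.

End Jacobi.

(** * Sign conditions on the imaginary axis *)

Section EvenPart.
Variable R : realFieldType.
Implicit Types (a b c m x : R) (p q r P Q : {poly R}) (n k : nat).

(** The even part in z, with m = z^2, of sum_j z^j p^(j)(0); applied to the derivative of p it gives
    the odd part divided by z. *)
Definition evp p : {poly R} := \poly_(k < size p) (p`_(2 * k) *+ (2 * k)`!).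

Lemma coef_evp p k : (evp p)`_k = p`_(2 * k) *+ (2 * k)`!.
Proof.
rewrite coef_poly; case: ltnP => // pk.
by rewrite nth_default ?mul0rn // (leq_trans pk) // leq_pmull.
Qed.

Lemma evp_is_linear : linear evp.
Proof.
by move=> c p q; apply/polyP => k; rewrite coefD coefZ !coef_evp coefD coefZ mulrnDl mulrnAr.
Qed.

HB.instance Definition _ := GRing.isLinear.Build R {poly R} {poly R} _ evp evp_is_linear.

Lemma evp1 : evp 1 = 1.
Proof. by apply/polyP => -[|k]; rewrite coef_evp !coef1 // mulnS mul0rn. Qed.

(** The inverse of the operator 1 - m D^2 applied to p; its value at 0 is [evp p] at m. *)
Definition even_derivs m p : {poly R} := \sum_(k < size p) m ^+ k *: p^`(2 * k).

Lemma even_derivsE m p N :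
  (size p <= N)%N -> even_derivs m p = \sum_(k < N) m ^+ k *: p^`(2 * k).
Proof.
move=> pN; rewrite /even_derivs (big_ord_widen _ (fun k => m ^+ k *: p^`(2 * k)) pN).
rewrite big_mkcond /=; apply: eq_bigr => k _; case: ltnP => // pk.
by rewrite poly.derivn_poly0 ?scaler0 // (leq_trans pk) // leq_pmull.
Qed.

Lemma size_deriv_le p n : (size p <= n.+1)%N -> (size p^`() <= n)%N.
Proof.
move=> pn; apply/leq_sizeP => j nj.
by rewrite coef_deriv nth_default ?mul0rn // (leq_trans pn).
Qed.

Lemma size_derivn_le p k : (size p^`(k) <= size p)%N.
Proof.
elim: k => [|k IH]; first by rewrite derivn0.
by rewrite derivnS size_deriv_le // (leq_trans IH).
Qed.

Lemma size_even_derivs m p : (size (even_derivs m p) <= size p)%N.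
Proof.
apply: (big_ind (fun q : {poly R} => (size q <= size p)%N)); first by rewrite size_poly0.
  by move=> q r hq hr; rewrite (leq_trans (size_polyD _ _)) // geq_max hq.
move=> k _; exact: leq_trans (size_scale_leq _ _) (size_derivn_le _ _).
Qed.

Lemma even_derivs0 m p : (even_derivs m p).[0] = (evp p).[m].
Proof.
rewrite horner_sum horner_poly; apply: eq_bigr => k _.
by rewrite hornerZ horner_coef0 coef_derivn addn0 ffactnn mulrC.
Qed.

Lemma deriv_even_derivs m p : (even_derivs m p)^`() = even_derivs m p^`().
Proof.
rewrite (@even_derivsE _ p^`() (size p)); last by rewrite size_deriv_le.
rewrite [LHS]linear_sum; apply: eq_bigr => k _.
by rewrite /= derivZ -derivnS derivSn.
Qed.

Lemma even_derivs_rec m p : even_derivs m p = p + m *: even_derivs m p^`()^`().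
Proof.
rewrite (@even_derivsE _ p (size p).+1) //.
rewrite (@even_derivsE _ p^`()^`() (size p)); last first.
  by rewrite size_deriv_le // ltnW // ltnS size_deriv_le.
rewrite big_ord_recl expr0 scale1r; congr (_ + _).
rewrite scaler_sumr; apply: eq_bigr => k _.
by rewrite lift0 scalerA -exprS mulnS add2n !derivSn.
Qed.

Lemma coef_even_derivs_top m p n : (size p <= n.+2)%N ->
  (even_derivs m p)`_n = p`_n /\ (size (even_derivs m p - p)%R <= n)%N.
Proof.
move=> pn; have s2 : (size p^`()^`() <= n)%N by rewrite !size_deriv_le.
have se := leq_trans (size_even_derivs m _) s2.
rewrite even_derivs_rec coefD coefZ (nth_default _ se).
by rewrite mulr0 addr0 addrAC subrr add0r; split=> //; rewrite (leq_trans (size_scale_leq _ _)).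
Qed.

(* With z = sqrt m, f = sum_j z^j P^(j) and g = sum_j z^j Q^(j), the polynomial
   g(0) f - f(0) g vanishes at 0; r0 and r1 are the even and odd parts in z of
   its quotient by 'X. The last two identities split z h' = h - p, where
   h = 'X * (r0 + z r1) and p = g(0) P - f(0) Q. *)
Lemma even_odd_quotients P Q n m : (size P <= n.+2)%N -> (size Q <= n.+1)%N ->
  let e := (evp P).[m] in let o := (evp P^`()).[m] in
  let e' := (evp Q).[m] in let o' := (evp Q^`()).[m] in
  exists r0 r1,
  [/\ (size ('X * r0 - e' *: P)%R <= n.+1)%N /\
      ('X * r0 - e' *: P)`_n = m * o' * (n.+1%:R * P`_n.+1) - e * Q`_n,
      (size ('X * r1 - o' *: P)%R <= n.+1)%N /\
      ('X * r1 - o' *: P)`_n = e' * (n.+1%:R * P`_n.+1) - o * Q`_n,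
      ('X * r0)^`() = 'X * r1 - (o' *: P - o *: Q)
    & m *: ('X * r1)^`() = 'X * r0 - (e' *: P - e *: Q)].
Proof.
move=> sP sQ e o e' o'.
pose U := even_derivs m P; pose V := even_derivs m P^`().
pose S := even_derivs m Q; pose T := even_derivs m Q^`().
(* Here f = U + z V, g = S + z T, f(0) = e + z o and g(0) = e' + z o'; expanding g(0) f - f(0) g
   with z^2 = m gives h0 + z h1. *)
pose h0 := e' *: U + (m * o') *: V - e *: S - (m * o) *: T.
pose h1 := o' *: U + e' *: V - o *: S - e *: T.
have mV : m *: V^`() = U - P.
  by rewrite deriv_even_derivs /U (even_derivs_rec m P) addrAC subrr add0r.
have mT : m *: T^`() = S - Q.
  by rewrite deriv_even_derivs /S (even_derivs_rec m Q) addrAC subrr add0r.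
have dU : U^`() = V := deriv_even_derivs m P.
have dS : S^`() = T := deriv_even_derivs m Q.
have fac h : h.[0] = 0 -> exists r, h = 'X * r.
  by move/rootP/factor_theorem=> [r ->]; exists r; rewrite subr0 mulrC.
have [|r0 h0E] := fac h0.
  by rewrite !hornerE !even_derivs0 -/e -/o -/e' -/o'; ring.
have [|r1 h1E] := fac h1.
  by rewrite !hornerE !even_derivs0 -/e -/o -/e' -/o'; ring.
have [_ sU] := coef_even_derivs_top m sP.
have sV : (size V <= n.+1)%N by rewrite (leq_trans (size_even_derivs _ _)) ?size_deriv_le.
have sS : (size S <= n.+1)%N by rewrite (leq_trans (size_even_derivs _ _)).
have sT : (size T <= n)%N by rewrite (leq_trans (size_even_derivs _ _)) ?size_deriv_le.
have Vn : V`_n = n.+1%:R * P`_n.+1.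
  have s3 : (size P^`() <= n.+2)%N by rewrite leqW ?size_deriv_le.
  by have [-> _] := coef_even_derivs_top m s3; rewrite coef_deriv mulr_natl.
have Sn : S`_n = Q`_n by have [-> _] := coef_even_derivs_top m (leqW sQ).
have Tn : T`_n = 0 by rewrite nth_default.
have Dn : (U - P)`_n = 0 by rewrite nth_default.
have sc c q k : (size q <= k)%N -> (size (c *: q)%R <= k)%N.
  by move=> sq; rewrite (leq_trans (size_scale_leq _ _)).
have sD p q k : (size p <= k)%N -> (size q <= k)%N -> (size (p + q)%R <= k)%N.
  by move=> sp sq; rewrite (leq_trans (size_polyD _ _)) // geq_max sp.
exists r0, r1; rewrite -h0E -h1E; split.
- have -> : h0 - e' *: P = e' *: (U - P) + (m * o') *: V + (- e) *: S + (- (m * o)) *: T.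
    by rewrite /h0 -!mul_polyC; ring.
  split; first by rewrite !sD // sc // ?leqW.
  by rewrite !coefD !coefZ Dn Vn Sn Tn; ring.
- have -> : h1 - o' *: P = o' *: (U - P) + e' *: V + (- o) *: S + (- e) *: T.
    by rewrite /h1 -!mul_polyC; ring.
  split; first by rewrite !sD // sc // ?leqW.
  by rewrite !coefD !coefZ Dn Vn Sn Tn; ring.
- rewrite /h0 /h1 !derivB derivD !derivZ dU dS [m * o']mulrC [m * o]mulrC.
  by rewrite -(scalerA o') -(scalerA o) mV mT -!mul_polyC; ring.
- rewrite /h0 /h1 !derivB derivD !derivZ dU dS.
  rewrite !scalerBr scalerDr !(scalerA m) ![m * _]mulrC -!(scalerA _ m) mV mT.
  by rewrite -!mul_polyC; ring.
Qed.

End EvenPart.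

(** * Imaginary and real parts of F_(n+1) / F_n from quadratic forms *)

Section JacobiSigns.
Variable R : realFieldType.
Variables (a b : R).
Implicit Types (m x : R) (p q r P Q : {poly R}) (n k : nat).

Let ev n := evp (jac a b n).
Let od n := evp (jac a b n)^`().

(** Twice the integrand is (1 - a) r^2 plus (a + 1) r^2 + s (r^2)'. The first term is positive for a
    < 1, the second becomes a square after integration by parts. *)
Lemma jint_mulX_deriv r : -1 < a < 1 -> 0 < b ->
  0 <= jint a b (r * ('X * r)^`()) ?= iff (r == 0).
Proof.
case/andP=> a1 a2 b0; suff [h0 h1] : 0 <= jint a b (r * ('X * r)^`()) /\
    (r != 0 -> 0 < jint a b (r * ('X * r)^`())).
  split=> //; apply/idP/idP => [/eqP E|/eqP->]; last by rewrite mul0r linear0.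
  by apply/negPn/negP => /h1; rewrite -E ltxx.
have E : 2 * jint a b (r * ('X * r)^`()) =
    (1 - a) * jint a b (r * r) + (a + 1) * jint (a + 1) (b - 1) (r * r).
  rewrite -jint_by_parts // -!linearZ -linearD /=; congr jint.
  by rewrite !derivM derivX -!mul_polyC; ring.
have b1 : -1 < b by lra.
have b2 : -1 < b - 1 by lra.
have a3 : -1 < a + 1 by lra.
have p2 : 0 <= (a + 1) * jint (a + 1) (b - 1) (r * r).
  by rewrite mulr_ge0 ?jint_sqr_ge0 //; lra.
have p1 : 0 <= (1 - a) * jint a b (r * r) by rewrite mulr_ge0 ?jint_sqr_ge0 //; lra.
split; first lra.
move=> r0; have : 0 < (1 - a) * jint a b (r * r) by rewrite mulr_gt0 ?jint_sqr_gt0 //; lra.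
by lra.
Qed.

(** Absorbing a factor -s into the weight raises a by one; then -2 times the integrand becomes (a +
    2) r^2 + s (r^2)' - a r^2. Integration by parts makes the first two terms a positive square, and
    -a is nonnegative. *)
Lemma jint_mulX_mulX_deriv r : -1 < a <= 0 -> 0 < b ->
  jint a b ('X * r * ('X * r)^`()) <= 0 ?= iff (r == 0).
Proof.
case/andP=> a1 a2 b0; suff [h0 h1] : jint a b ('X * r * ('X * r)^`()) <= 0 /\
    (r != 0 -> jint a b ('X * r * ('X * r)^`()) < 0).
  split=> //; apply/idP/idP => [/eqP E|/eqP->]; last by rewrite mulr0 mul0r linear0.
  by apply/negPn/negP => /h1; rewrite E ltxx.
have b1 : -1 < b by lra.
have b2 : -1 < b - 1 by lra.
have a3 : -1 < a + 1 by lra.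
have a4 : -1 < a + 1 + 1 by lra.
have E : - 2 * jint a b ('X * r * ('X * r)^`()) =
    (a + 1) / (a + b + 2) *
    ((a + 1 + 1) * jint (a + 1 + 1) (b - 1) (r * r) - a * jint (a + 1) b (r * r)).
  rewrite -jint_by_parts // -[a * _]linearZ -linearB -jint_mulNX // -[LHS]linearZ /=.
  by congr jint; rewrite !derivM derivX -!mul_polyC; ring.
have c0 : 0 < (a + 1) / (a + b + 2) by rewrite divr_gt0 //; lra.
have p1 : 0 <= - a * jint (a + 1) b (r * r) by rewrite mulr_ge0 ?jint_sqr_ge0 //; lra.
have p2 : 0 <= (a + 1 + 1) * jint (a + 1 + 1) (b - 1) (r * r).
  by rewrite mulr_ge0 ?jint_sqr_ge0 //; lra.
split.
  by rewrite -oppr_ge0 -(pmulr_rge0 _ (ltr0Sn R 1)) mulrN -mulNr E mulr_ge0 ?(ltW c0) //; lra.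
move=> r0; have p3 : 0 < (a + 1 + 1) * jint (a + 1 + 1) (b - 1) (r * r).
  by rewrite mulr_gt0 ?jint_sqr_gt0 //; lra.
by rewrite -oppr_gt0 -(pmulr_rgt0 _ (ltr0Sn R 1)) mulrN -mulNr E mulr_gt0 //; lra.
Qed.

(* The sign of the imaginary part of F_{n+1} / F_n on the imaginary axis, where
   F_n(z) = ev_n(z^2) + z od_n(z^2). *)
Lemma jac_cross_gt0_step n m : -1 < a < 1 -> 0 < b -> m < 0 ->
  ((ev n).[m] != 0) || ((od n).[m] != 0) ->
  0 < (od n.+1).[m] * (ev n).[m] - (ev n.+1).[m] * (od n).[m].
Proof.
move=> ha b0 m0 nz; have a1 : -1 < a by case/andP: ha.
have b1 : -1 < b by lra.
have [K1 K1_gt0 hK1] := jint_jac n.+1 a1 b1.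
have [K K_gt0 hK] := jint_jac n a1 b1.
have sP := size_jac n.+1 a1 b1; have sQ := size_jac n a1 b1.
have l_gt0 := coef_jac_gt0 a1 b1 (leqnn n.+1).
have [||r0 [r1 []]] := @even_odd_quotients _ (jac a b n.+1) (jac a b n) n m.
- by rewrite sP.
- by rewrite sQ.
rewrite -/(ev n) -/(od n) -/(ev n.+1) -/(od n.+1).
set e := (ev n.+1).[m]; set o := (od n.+1).[m].
set e' := (ev n).[m] in nz *; set o' := (od n).[m] in nz *.
set P := jac a b n.+1 in hK1 sP l_gt0 *; set Q := jac a b n in hK sQ *.
move=> [s0 _] [s1 _] d0 d1.
(* Each quotient has degree at most n, so it is orthogonal to P and its pairing with Q sees only its
   n-th coefficient. *)
have top r c : (size ('X * r - c *: P)%R <= n.+1)%N ->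
    (size r <= n.+1)%N /\ r`_n = c * P`_n.+1.
  move=> sr; split.
    apply/leq_sizeP => j nj; have : ('X * r - c *: P)`_j.+1 = 0.
      by rewrite nth_default // (leq_trans sr) // leqW.
    by rewrite coefB coefXM coefZ /= [P`__]nth_default ?mulr0 ?subr0 // sP.
  have : ('X * r - c *: P)`_n.+1 = 0 by rewrite nth_default.
  by rewrite coefB coefXM coefZ /= => /eqP; rewrite subr_eq0 => /eqP.
have [sr0 r0n] := top _ _ s0; have [sr1 r1n] := top _ _ s1.
(* The coefficient of z in the pairing of z h' with r0 - z r1, the conjugate of h / s. After
   substituting [d0] and [d1] the terms in 'X r0 r1 cancel. *)
have E : jint a b (r0 * ('X * r0)^`()) - m * jint a b (r1 * ('X * r1)^`()) =
    K * P`_n.+1 * (o * e' - e * o').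
  rewrite -linearZ -linearB /= scalerAr d0 d1.
  have -> : r0 * ('X * r1 - (o' *: P - o *: Q)) - r1 * ('X * r0 - (e' *: P - e *: Q)) =
    - o' *: (P * r0) + o *: (Q * r0) + e' *: (P * r1) - e *: (Q * r1).
    by rewrite -!mul_polyC; ring.
  rewrite linearB !linearD !linearZ /= !hK // (hK1 _ (leqW sr0)) (hK1 _ (leqW sr1)) r0n r1n.
  by rewrite !(nth_default _ sr0) !(nth_default _ sr1); ring.
have q0 := jint_mulX_deriv r0 ha b0; have q1 := jint_mulX_deriv r1 ha b0.
rewrite -(pmulr_rgt0 _ (mulr_gt0 K_gt0 l_gt0)) -E.
(* Strictness: a nonzero e' or o' is the factor c in the top coefficient of r0 or r1, so that
   quotient is nonzero. *)
have pos r c : c != 0 -> r`_n = c * P`_n.+1 -> 0 < jint a b (r * ('X * r)^`()).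
  move=> c0 rn; rewrite (lt_leif (jint_mulX_deriv r ha b0)).
  apply: contraNneq c0 => r00; move/eqP: rn; rewrite r00 coef0 eq_sym mulf_eq0.
  by rewrite (gt_eqF l_gt0) orbF.
have m1 : 0 < - m by rewrite oppr_gt0.
rewrite -mulNr; case/orP: nz => nz.
  by rewrite ltr_pwDl ?(pos _ _ nz r0n) // mulr_ge0 ?q1 ?(ltW m1).
by rewrite ltr_wpDl ?q0 // mulr_gt0 // (pos _ _ nz r1n).
Qed.

(** For z^2 = m the expression is the real part of F_(n+1) times the conjugate of F_n. It appears on
    pairing z h' with the conjugate of h itself. *)
Lemma jac_dot_gt0_step n m : -1 < a <= 0 -> 0 < b -> m < 0 ->
  ((ev n).[m] != 0) || ((od n).[m] != 0) ->
  0 < (ev n.+1).[m] * (ev n).[m] - m * (od n.+1).[m] * (od n).[m].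
Proof.
move=> ha b0 m0 nz; have a1 : -1 < a by case/andP: ha.
have b1 : -1 < b by lra.
have [K1 K1_gt0 hK1] := jint_jac n.+1 a1 b1.
have [K K_gt0 hK] := jint_jac n a1 b1.
have sP := size_jac n.+1 a1 b1; have sQ := size_jac n a1 b1.
have l_gt0 := coef_jac_gt0 a1 b1 (leqnn n.+1).
have [||r0 [r1 []]] := @even_odd_quotients _ (jac a b n.+1) (jac a b n) n m.
- by rewrite sP.
- by rewrite sQ.
rewrite -/(ev n) -/(od n) -/(ev n.+1) -/(od n.+1).
set e := (ev n.+1).[m]; set o := (od n.+1).[m].
set e' := (ev n).[m] in nz *; set o' := (od n).[m] in nz *.
set P := jac a b n.+1 in hK1 sP l_gt0 *; set Q := jac a b n in hK sQ *.
set t0 := 'X * r0 - e' *: P; set t1 := 'X * r1 - o' *: P.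
move=> [s0 c0] [s1 c1] d0 d1.
have top r c : (size ('X * r - c *: P)%R <= n.+1)%N -> r`_n = c * P`_n.+1.
  move=> sr; have : ('X * r - c *: P)`_n.+1 = 0 by rewrite nth_default.
  by rewrite coefB coefXM coefZ /= => /eqP; rewrite subr_eq0 => /eqP.
have r0n := top _ _ s0; have r1n := top _ _ s1.
have PQ : jint a b (P * Q) = 0 by rewrite hK1 ?sQ // nth_default ?mulr0 ?sQ.
(* Removing multiples of P leaves [t0] and [t1] of degree at most n, orthogonal to P. In the
   pairings with Q, the contributions of the top coefficient of Q cancel. *)
have E : jint a b ('X * r0 * ('X * r0)^`()) - m * jint a b ('X * r1 * ('X * r1)^`()) =
    - (K * (n.+1%:R * P`_n.+1)) * (e * e' - m * o * o').
  rewrite -linearZ -linearB /= scalerAr d0 d1.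
  have -> : 'X * r0 * ('X * r1 - (o' *: P - o *: Q)) - 'X * r1 * ('X * r0 - (e' *: P - e *: Q)) =
    (o * e' - e * o') *: (P * Q) + e' *: (P * t1) - o' *: (P * t0)
    + (o *: (Q * t0) - e *: (Q * t1)).
    by rewrite /t0 /t1 -!mul_polyC; ring.
  rewrite linearD !linearB linearD !linearZ /= PQ !hK // (hK1 _ (leqW s0)) (hK1 _ (leqW s1)).
  by rewrite !(nth_default _ s0) !(nth_default _ s1) c0 c1; ring.
have q0 := jint_mulX_mulX_deriv r0 ha b0; have q1 := jint_mulX_mulX_deriv r1 ha b0.
have w0 : 0 < K * (n.+1%:R * P`_n.+1) by rewrite !mulr_gt0 ?ltr0n.
rewrite -(pmulr_rgt0 _ w0) -oppr_lt0 -mulNr -E.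
have neg r c : c != 0 -> r`_n = c * P`_n.+1 -> jint a b ('X * r * ('X * r)^`()) < 0.
  move=> cn0 rn; rewrite (lt_leif (jint_mulX_mulX_deriv r ha b0)).
  apply: contraNneq cn0 => r00; move/eqP: rn; rewrite r00 coef0 eq_sym mulf_eq0.
  by rewrite (gt_eqF l_gt0) orbF.
have m1 : 0 < - m by rewrite oppr_gt0.
rewrite -mulNr; case/orP: nz => nz.
  by rewrite ltr_wnDr ?(neg _ _ nz r0n) // mulr_ge0_le0 ?q1 ?(ltW m1).
by rewrite ltr_wnDl ?q0 // pmulr_rlt0 // (neg _ _ nz r1n).
Qed.

(** Positivity at one index shows that the next even and odd values are not both zero, which is what
    the following step requires. *)
Lemma jac_cross_gt0 n m : -1 < a < 1 -> 0 < b -> m < 0 ->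
  0 < (od n.+1).[m] * (ev n).[m] - (ev n.+1).[m] * (od n).[m].
Proof.
move=> ha b0 m0; elim: n => [|n IH]; apply: jac_cross_gt0_step => //.
  by rewrite /ev jac0 evp1 hornerC oner_neq0.
rewrite -negb_and; apply/negP => /andP[/eqP e0 /eqP o0].
by move: IH; rewrite e0 o0 !mul0r subr0 ltxx.
Qed.

Lemma jac_dot_gt0 n m : -1 < a <= 0 -> 0 < b -> m < 0 ->
  0 < (ev n.+1).[m] * (ev n).[m] - m * (od n.+1).[m] * (od n).[m].
Proof.
move=> ha b0 m0; elim: n => [|n IH]; apply: jac_dot_gt0_step => //.
  by rewrite /ev jac0 evp1 hornerC oner_neq0.
rewrite -negb_and; apply/negP => /andP[/eqP e0 /eqP o0].
by move: IH; rewrite e0 o0 mul0r mulr0 mul0r subr0 ltxx.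
Qed.

End JacobiSigns.

(** * Lowering the second parameter by a contiguous relation *)

Section Contiguous.
Variable R : realFieldType.
Implicit Types (a b c m x : R) (p q r P Q : {poly R}) (n k : nat).

Lemma jac_contiguous a b n : -1 < a -> 0 < b ->
  jac a (b - 1) n.+1 =
  ((n.+1%:R + a + b) / (n.+1%:R + n.+1%:R + a + b)) *: jac a b n.+1
  + (n.+1%:R / (n.+1%:R + n.+1%:R + a + b)) *: jac a b n.
Proof.
move=> ha hb; apply/polyP => k; rewrite coefD !coefZ !coef_jac.
have n1 : 1 <= n.+1%:R :> R by rewrite ler1n.
set y := n.+1%:R + a + b.
have -> : n.+1%:R + a + (b - 1) + 1 = y by rewrite /y; ring.
have -> : n%:R + a + b + 1 = y by rewrite /y -natr1; ring.
have -> : n.+1%:R + n.+1%:R + a + b = y + n.+1%:R by rewrite /y; ring.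
have y0 : y != 0 by apply/lt0r_neq0; rewrite /y; lra.
have yn0 : y + n.+1%:R != 0 by apply/lt0r_neq0; rewrite /y; lra.
have p0 : poch (a + 1) k != 0 by apply/lt0r_neq0/poch_gt0; lra.
rewrite (poch_shift k y0).
have bk : n.+1%:R * 'C(n, k)%:R = (n.+1%:R - k%:R) * 'C(n.+1, k)%:R :> R.
  rewrite -natrM (mul_bin_down n.+1 k) natrM; have [kn|nk] := leqP k n.+1; first by rewrite natrB.
  by rewrite bin_small // !mulr0.
apply: (mulfI yn0).
transitivity (((y + k%:R) * 'C(n.+1, k)%:R + n.+1%:R * 'C(n, k)%:R) * poch y k / poch (a + 1) k).
  by rewrite bk; field.
by move: n.+1%:R yn0 => N yn0; field; rewrite yn0 y0 p0.
Qed.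

(** With b + 1 in place of b, the ratios F_(n+1) / F_n lie in the open first quadrant, so a product
    of two consecutive ones has positive imaginary part. The contiguous relation expands the cross
    term into these positive ones. *)
Lemma jac_cross_gt0_neg a b n m : -1 < a < 0 -> -1 < b -> m < 0 ->
  0 < (evp (jac a b n.+1)^`()).[m] * (evp (jac a b n)).[m]
      - (evp (jac a b n.+1)).[m] * (evp (jac a b n)^`()).[m].
Proof.
move=> /andP[a1 a0] b1 m0.
case: n => [|n].
  rewrite jac0 evp1 hornerC mulr1 derivC linear0 horner0 mulr0 subr0.
  have -> : (jac a b 1)^`() = ((jac a b 1)`_1)%:P.
    apply/polyP => -[|k]; rewrite coef_deriv coefC // nth_default ?mul0rn //.
    by rewrite size_jac.
  by rewrite -alg_polyC linearZ /= evp1 alg_polyC hornerC coef_jac_gt0.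
have ha : -1 < a < 1 by rewrite a1; lra.
have ha' : -1 < a <= 0 by rewrite a1 ltW.
have b0 : 0 < b + 1 by lra.
have {1 2 3 4}-> : b = b + 1 - 1 by ring.
rewrite !jac_contiguous //.
have n1 : 1 <= n.+1%:R :> R by rewrite ler1n.
have n2 : 1 <= n.+2%:R :> R by rewrite ler1n.
set A := (n.+2%:R + _ + _) / _; set B := n.+2%:R / _.
set A' := (n.+1%:R + _ + _) / _; set B' := n.+1%:R / _.
have A0 : 0 < A by rewrite divr_gt0; lra.
have B0 : 0 < B by rewrite divr_gt0; lra.
have A'0 : 0 < A' by rewrite divr_gt0; lra.
have B'0 : 0 < B' by rewrite divr_gt0; lra.
rewrite !derivD !derivZ !linearD !linearZ /= !hornerD !hornerZ.
have := jac_dot_gt0 n ha' b0 m0; have := jac_dot_gt0 n.+1 ha' b0 m0.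
have := jac_cross_gt0 n ha b0 m0; have := jac_cross_gt0 n.+1 ha b0 m0.
move: (jac a (b + 1) n.+2) (jac a (b + 1) n.+1) (jac a (b + 1) n) => P2 P1 P0.
move: (evp P2).[m] (evp P1).[m] (evp P0).[m] => e2 e1 e0.
move: (evp P2^`()).[m] (evp P1^`()).[m] (evp P0^`()).[m] => o2 o1 o0.
clearbody A B A' B'; clear -m0 A0 B0 A'0 B'0.
move=> c21 c10 d21 d10.
(* The squared modulus of the middle F, which clears the denominator in the product of the two
   ratios. *)
have n1 : 0 < e1 * e1 - m * o1 * o1.
  have sq_gt0 (z : R) : z != 0 -> 0 < z * z by move=> z0; rewrite -expr2 exprn_even_gt0.
  have m1 : 0 < - m by rewrite oppr_gt0.
  rewrite -mulrA -mulNr; have [e10|e1N0] := eqVneq e1 0.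
    rewrite e10 mulr0 add0r mulr_gt0 // sq_gt0 //.
    by apply/eqP => o10; move: c21; rewrite e10 o10 !mulr0 subrr ltxx.
  by rewrite ltr_pwDl ?sq_gt0 // mulr_ge0 ?(ltW m1) // -expr2 sqr_ge0.
have c20 : 0 < o2 * e0 - e2 * o0.
  rewrite -(pmulr_rgt0 _ n1).
  have -> : (e1 * e1 - m * o1 * o1) * (o2 * e0 - e2 * o0) =
    (o2 * e1 - e2 * o1) * (e1 * e0 - m * o1 * o0)
    + (e2 * e1 - m * o2 * o1) * (o1 * e0 - e1 * o0) by ring.
  by rewrite addr_gt0 // mulr_gt0.
have -> : (A * o2 + B * o1) * (A' * e1 + B' * e0) - (A * e2 + B * e1) * (A' * o1 + B' * o0) =
  A * A' * (o2 * e1 - e2 * o1) + A * B' * (o2 * e0 - e2 * o0) + B * B' * (o1 * e0 - e1 * o0).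
  by ring.
by rewrite !addr_gt0 // !mulr_gt0.
Qed.

End Contiguous.

(** * Locating roots by sign changes; roots are indexed in decreasing order *)

Section Roots.
Variable R : rcfType.
Implicit Types (x y : R) (p q : {poly R}) (k l i j n : nat) (r s t : nat -> R).

Lemma decr_lt k r i j : (forall i, (i.+1 < k)%N -> r i.+1 < r i) ->
  (i < j < k)%N -> r j < r i.
Proof.
move=> dr; elim: j => // j IH /andP[]; rewrite ltnS leq_eqVlt => /orP[/eqP->|ij] jk.
  exact: dr.
by apply: lt_trans (dr _ jk) (IH _); rewrite ij ltnW.
Qed.

Lemma far_left_sign p k y : size p = k.+1 -> 0 < lead_coef p ->
  exists2 x, x < y & 0 < (-1) ^+ k * p.[x].
Proof.
move=> sp lp; pose q := (-1) ^+ k *: (p \Po - 'X).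
have lq : 0 < lead_coef q.
  rewrite lead_coefZ lead_coef_comp ?size_polyN ?size_polyX // lead_coefN lead_coefX sp /=.
  by rewrite mulrCA -exprD addnn -mul2n mulnC exprM sqrr_sign mulr1.
have [z hz] := poly_pinfty_gt_lc lq.
exists (- Num.max z (1 - y)); first by rewrite ltrNl lt_max orbC; apply/orP; left; lra.
have := hz (Num.max z (1 - y)); rewrite le_max lexx => /(_ isT)/(lt_le_trans lq).
by rewrite hornerZ horner_comp !hornerE.
Qed.

(** The r i are all the roots and exactly the first j exceed x, so exactly j linear factors are
    negative at x. *)
Lemma sign_between_roots p k r x j : size p = k.+1 -> 0 < lead_coef p ->
  (forall i, (i < k)%N -> root p (r i)) ->
  (forall i, (i.+1 < k)%N -> r i.+1 < r i) ->
  (j <= k)%N -> ((0 < j)%N -> x < r j.-1) -> ((j < k)%N -> r j < x) ->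
  0 < (-1) ^+ j * p.[x].
Proof.
move=> sp lp rp dr jk xl xr.
have above i : (i < j)%N -> x < r i.
  move=> ij; apply: lt_le_trans (xl _) _; first by lia.
  have [->//|ne] := eqVneq i j.-1; apply/ltW/(decr_lt dr); lia.
have below i : (j <= i < k)%N -> r i < x.
  move=> /andP[ji ik]; apply: le_lt_trans (xr _); last by lia.
  have [->//|ne] := eqVneq i j; apply/ltW/(decr_lt dr); lia.
have -> : p = lead_coef p *: \prod_(z <- mkseq r k) ('X - z%:P).
  apply: all_roots_prod_XsubC; first by rewrite size_mkseq.
    by apply/allP => z /mapP[i]; rewrite mem_iota => /andP[_ ik] ->; apply: rp.
  rewrite uniq_rootsE; apply/(uniqP 0) => i1 i2; rewrite !inE size_mkseq => h1 h2.
  rewrite !nth_mkseq //; case: (ltngtP i1 i2) => // lt_i E.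
    by have := @decr_lt k r i1 i2 dr; rewrite lt_i h2 E ltxx => /(_ isT).
  by have := @decr_lt k r i2 i1 dr; rewrite lt_i h1 E ltxx => /(_ isT).
rewrite hornerZ mulrCA mulr_gt0 // horner_prod big_map.
have -> : iota 0 k = index_iota 0 k by rewrite /index_iota subn0.
rewrite (big_cat_nat (leq0n j) jk) //= mulrA mulr_gt0 //.
  rewrite -[X in (-1) ^+ X]subn0 -prodr_const_nat -big_split /= big_nat prodr_gt0 // => i.
  by move=> ij; rewrite !hornerE mulN1r oppr_gt0 subr_lt0 above.
rewrite big_nat prodr_gt0 // => i ji.
by rewrite !hornerE subr_gt0 below.
Qed.

(** Intermediate values between consecutive test points; when K = k the last root comes from the
    sign of p far to the left. *)
Lemma roots_between p k K t : size p = k.+1 -> 0 < lead_coef p -> (k <= K)%N ->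
  (forall i, (i.+1 < K)%N -> t i.+1 < t i) ->
  (forall i, (i < K)%N -> 0 < (-1) ^+ i * p.[t i]) ->
  exists r, forall i, (i < k)%N ->
    [/\ root p (r i), r i < t i & (i.+1 < K)%N -> t i.+1 < r i].
Proof.
move=> sp lp kK dt st.
have step (i : 'I_k) : exists y, [/\ root p y, y < t i & (i.+1 < K)%N -> t i.+1 < y].
  have ik := ltn_ord i; have [z zt zs] : exists2 z, z < t i &
      0 < (-1) ^+ i.+1 * p.[z] /\ ((i.+1 < K)%N -> t i.+1 <= z).
    have [iK|iK] := ltnP i.+1 K; first by exists (t i.+1); rewrite ?dt ?st.
    have -> : i.+1 = k by lia.
    by have [z zt zs] := far_left_sign (t i) sp lp; exists z.
  have [|y] := @poly_ivtoo _ p z (t i) (ltW zt).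
    have [zs1 _] := zs; have := mulr_gt0 zs1 (st i (leq_trans ik kK)).
    have -> : (-1) ^+ i.+1 * p.[z] * ((-1) ^+ i * p.[t i]) = - (((-1) ^+ i) ^+ 2 * (p.[z] * p.[t i])).
      by rewrite exprS; ring.
    by rewrite sqrr_sign mul1r oppr_gt0.
  rewrite in_itv /= => /andP[zy yt] ry; exists y; split=> // iK.
  by apply: le_lt_trans zy; case: zs => _; apply.
have [u hu] := fin_all_exists step.
exists (fun i => if insub i is Some j then u j else 0) => i ik.
by rewrite insubT; apply: (hu (Ordinal ik)).
Qed.


End Roots.

(** * From sign conditions to interlacing *)

Section Interlacing.
Variable R : rcfType.
Implicit Types (x y : R) (p q : {poly R}) (k l i j n : nat) (r s t : nat -> R).

(** For l <= k <= l + 1 this is the chain r 0 > s 0 > r 1 > s 1 > ..., with the largest zero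
    belonging to r. *)
Definition alternating k l r s :=
  (forall i, (i < k)%N -> (i < l)%N -> s i < r i) /\
  (forall i, (i.+1 < k)%N -> r i.+1 < s i).

Lemma alternating_lt k l r s : (l <= k <= l.+1)%N -> alternating k l r s ->
  forall i j, (i < k)%N -> (j < l)%N ->
  (s j < r i) = (i <= j)%N /\ (r i < s j) = (j < i)%N.
Proof.
move=> /andP[lk kl] [sr rs] i j ik jl.
have dr i0 : (i0.+1 < k)%N -> r i0.+1 < r i0.
  by move=> h; apply: lt_trans (rs _ h) (sr _ _ _); lia.
have [ij|ji] := leqP i j.
  suff h : s j < r i by rewrite h (lt_gtF h).
  apply: lt_le_trans (sr j _ _) _; rewrite ?(leq_trans jl) //.
  have [->//|ne] := eqVneq i j; apply/ltW/(decr_lt dr); lia.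
suff h : r i < s j by rewrite h (lt_gtF h).
apply: le_lt_trans (rs j _); last by lia.
have [->//|ne] := eqVneq i j.+1; apply/ltW/(decr_lt dr); lia.
Qed.

Lemma interlace_of_alternating p q k l r s :
  size p = k.+1 -> size q = l.+1 -> (l <= k <= l.+1)%N ->
  (forall i, (i < k)%N -> root p (r i)) -> (forall i, (i < l)%N -> root q (s i)) ->
  alternating k l r s -> interlace p q.
Proof.
move=> sp sq kl rp rq alt; have ord := alternating_lt kl alt.
case: alt => sr rs; case/andP: kl => lk kl.
have rev_nth (u : nat -> R) k0 i : (i < k0)%N -> (rev (mkseq u k0))`_i = u (k0 - i.+1)%N :> R.
  by move=> ik; rewrite nth_rev ?size_mkseq // nth_mkseq //; lia.
have dec_sorted (u : nat -> R) k0 : (forall i, (i.+1 < k0)%N -> u i.+1 < u i) ->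
    sorted <%R (rev (mkseq u k0)).
  move=> du; apply/(sortedP (0 : R)) => i; rewrite size_rev size_mkseq => ik.
  rewrite !rev_nth //; last exact: ltnW.
  have -> : (k0 - i.+1 = (k0 - i.+2).+1)%N by lia.
  by apply: du; lia.
have dr i : (i.+1 < k)%N -> r i.+1 < r i.
  by move=> h; apply: lt_trans (rs _ h) (sr _ _ _); lia.
have ds i : (i.+1 < l)%N -> s i.+1 < s i.
  by move=> h; apply: lt_trans (sr _ _ h) (rs _ _); lia.
have decomp (f : {poly R}) (u : nat -> R) k0 : size f = k0.+1 -> (forall i, (i < k0)%N -> root f (u i)) ->
    sorted <%R (rev (mkseq u k0)) ->
    f = lead_coef f *: \prod_(z <- rev (mkseq u k0)) ('X - z%:P).
  move=> sf rf su; apply: all_roots_prod_XsubC.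
  - by rewrite size_rev size_mkseq.
  - by rewrite all_rev; apply/allP => z /mapP[i]; rewrite mem_iota => /andP[_ ik] ->; apply: rf.
  - by rewrite uniq_rootsE (sorted_uniq lt_trans ltxx).
(* Reversed, since [interlace] asks for increasing lists. The gap from r (j+1) to r j contains only
   s j, and that from s (j+1) to s j only r (j+1). *)
exists (rev (mkseq r k)), (rev (mkseq s l)).
rewrite -!size_poly_gt0 sp sq; do 2![split=> //].
do 4![split; first by [apply: dec_sorted | apply: decomp => //; apply: dec_sorted]].
have count1 (P : pred R) (u : nat -> R) k0 j : (j < k0)%N ->
    (forall i, (i < k0)%N -> P (u i) = (i == j)) -> count P (rev (mkseq u k0)) = 1%N.
  move=> jk hP; rewrite count_rev count_map.
  rewrite (@eq_in_count _ _ (pred1 j)); last first.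
    by move=> i; rewrite mem_iota /= => ik; rewrite hP.
  by rewrite count_uniq_mem ?iota_uniq // mem_iota /= add0n jk.
split; last split.
- move=> x; rewrite !mem_rev => /mapP[i]; rewrite mem_iota => /andP[_ ik] ->.
  apply/mapP => -[j]; rewrite mem_iota => /andP[_ jl] E.
  by have [] := ord i j ik jl; rewrite E !ltxx; case: ltngtP.
- move=> i; rewrite size_rev size_mkseq => ik; rewrite !rev_nth //; last exact: ltnW.
  have -> : (k - i.+1 = (k - i.+2).+1)%N by lia.
  apply: (@count1 _ _ _ (k - i.+2)%N); first lia.
  move=> j jl; have [|_ ->] := ord (k - i.+2).+1 j _ jl; first lia.
  have [|-> _] := ord (k - i.+2)%N j _ jl; first lia.
  by rewrite ltnS -eqn_leq.
- move=> i; rewrite size_rev size_mkseq => il; rewrite !rev_nth //; last exact: ltnW.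
  have -> : (l - i.+1 = (l - i.+2).+1)%N by lia.
  apply: (@count1 _ _ _ (l - i.+2).+1); first lia.
  move=> j jk; have [|-> _] := ord j (l - i.+2).+1 jk; first lia.
  have [|_ ->] := ord j (l - i.+2)%N jk; first lia.
  by rewrite -eqn_leq.
Qed.

Lemma interlaceZ p q c d : c != 0 -> d != 0 -> interlace p q -> interlace (c *: p) (d *: q).
Proof.
move=> c0 d0 [rp [rq [p0 [q0 [sp [sq [pE [qE H]]]]]]]].
exists rp, rq; rewrite !scaler_eq0 !negb_or c0 d0 p0 q0 !lead_coefZ -!scalerA -pE -qE.
by do 6![split; first by []]; exact: H.
Qed.

(** * Induction on the degree from positive cross terms *)

Section CrossPositive.

Variables E O : nat -> {poly R}.
Hypothesis size_E : forall n, size (E n) = n./2.+1.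
Hypothesis size_O : forall n, size (O n.+1) = n./2.+1.
Hypothesis lead_E : forall n, 0 < lead_coef (E n).
Hypothesis lead_O : forall n, 0 < lead_coef (O n.+1).
Hypothesis E_gt0 : forall n, 0 < (E n).[0].
Hypothesis O_gt0 : forall n, 0 < (O n.+1).[0].
Hypothesis cross_gt0 : forall n m, m < 0 ->
  0 < (O n.+1).[m] * (E n).[m] - (E n.+1).[m] * (O n).[m].

(** The zero pattern of the Hermite-Biehler criterion for stability of E(z^2) + z O(z^2). *)
Let hermite_biehler n e o :=
  [/\ forall i, (i < n.+1./2)%N -> root (E n.+1) (e i) /\ e i < 0,
      forall i, (i < n./2)%N -> root (O n.+1) (o i)
    & alternating n.+1./2 n./2 e o].

(** At a zero of one factor the cross inequality fixes the sign of a product of two others. So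
    E_(n+2) is opposite to O_(n+1) at the e', while O_(n+2) agrees with E_(n+1) both at the new e
    and at the o'. The zeros of O_(n+2) are thus located twice, as o against e and as t against
    o'. *)
Lemma hermite_biehler_step n e' o' : hermite_biehler n e' o' ->
  exists e o t,
  [/\ hermite_biehler n.+1 e o, alternating n.+2./2 n.+1./2 e e',
      forall i, (i < n.+1./2)%N -> root (O n.+2) (t i)
    & alternating n.+1./2 n./2 t o'].
Proof.
move=> [re' ro' alt']; have [oe' eo'] := alt'.
have kl : (n./2 <= n.+1./2 <= n./2.+1)%N by lia.
have de' i : (i.+1 < n.+1./2)%N -> e' i.+1 < e' i.
  by move=> h; apply: lt_trans (eo' _ h) (oe' _ _ _); lia.
have do' i : (i.+1 < n./2)%N -> o' i.+1 < o' i.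
  by move=> h; apply: lt_trans (oe' _ _ h) (eo' _ _); lia.
have e'_lt0 i : (i < n.+1./2)%N -> e' i < 0 by case/re'.
have o'_lt0 i : (i < n./2)%N -> o' i < 0.
  by move=> h; apply: lt_trans (oe' i _ h) (e'_lt0 i _); lia.
have re'0 i : (i < n.+1./2)%N -> (E n.+1).[e' i] = 0 by case/re' => /rootP.
have ro'0 i : (i < n./2)%N -> (O n.+1).[o' i] = 0 by move/ro'/rootP.
have sgnO i : (i < n.+1./2)%N -> 0 < (-1) ^+ i * (O n.+1).[e' i].
  move=> ik; apply: (sign_between_roots (size_O n) (lead_O n) ro' do'); first lia.
    by move=> i0; rewrite -[X in e' X](prednK i0) eo' //; lia.
  exact: oe'.
have sgn2 i y z : 0 < (-1) ^+ i * y -> 0 < y * z -> 0 < (-1) ^+ i * z :> R.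
  move=> h1 h2; have := mulr_gt0 h1 h2.
  have -> : (-1) ^+ i * y * (y * z) = y ^+ 2 * ((-1) ^+ i * z) by ring.
  rewrite pmulr_rgt0 // exprn_even_gt0 //=.
  by apply: contraTneq h1 => ->; rewrite mulr0 ltxx.
have sgnE i : (i < n./2)%N -> 0 < (-1) ^+ i.+1 * (E n.+1).[o' i].
  move=> il; apply: (sign_between_roots (size_E _) (lead_E _) (fun i h => (re' i h).1) de'); first lia.
    by move=> _; apply: oe'; lia.
  by move=> h; apply: eo'.
(* The point 0, where the new polynomials are positive, is added as the largest test point; it
   supplies the first sign change and keeps the new zeros negative. *)
pose cons0 (u : nat -> R) i := if i is j.+1 then u j else 0.
have [|||e He] := @roots_between _ _ _ n.+1./2.+1 (cons0 e') (size_E n.+2) (lead_E n.+2).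
- lia.
- by case=> [|i] h /=; [apply: e'_lt0|apply: de'].
- case=> [|i] h /=; first by rewrite mul1r.
  rewrite exprS -mulrA mulN1r -mulrN; apply: (sgn2 _ _ _ (sgnO i h)).
  by have := cross_gt0 n.+1 (e'_lt0 i h); rewrite re'0 // mulr0 sub0r mulrN mulrC.
have alt_ee' : alternating n.+2./2 n.+1./2 e e'.
  split=> i; first by move=> h1 h2; have [_ _ /(_ h2)] := He i h1.
  by move=> h; have [_ h1 _] := He _ h.
have [ee' e'e] := alt_ee'.
have e_lt0 i : (i < n.+2./2)%N -> e i < 0.
  move=> h; have [_ h1 _] := He i h; apply: (lt_le_trans h1).
  by case: i h {h1} => [|i] h //=; apply/ltW/e'_lt0; lia.
have de i : (i.+1 < n.+2./2)%N -> e i.+1 < e i.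
  by move=> h; apply: lt_trans (e'e _ h) (ee' _ _ _); lia.
have re0 i : (i < n.+2./2)%N -> (E n.+2).[e i] = 0 by move=> h; have [/rootP] := He i h.
have [||o Ho] := @roots_between _ _ _ n.+2./2 e (size_O n.+1) (lead_O n.+1) _ de.
- lia.
- move=> i h; have h1 : 0 < (-1) ^+ i * (E n.+1).[e i].
    apply: (sign_between_roots (size_E _) (lead_E _) (fun i h => (re' i h).1) de'); first lia.
      by move=> i0; rewrite -[X in e X](prednK i0) e'e //; lia.
    by move=> h1; apply: ee'.
  apply: (sgn2 _ _ _ h1).
  by have := cross_gt0 n.+1 (e_lt0 i h); rewrite re0 // mul0r subr0 mulrC.
have [|||t Ht] := @roots_between _ _ _ n./2.+1 (cons0 o') (size_O n.+1) (lead_O n.+1).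
- lia.
- by case=> [|i] h /=; [apply: o'_lt0|apply: do'].
- case=> [|i] h /=; first by rewrite mul1r.
  apply: (sgn2 _ _ _ (sgnE i h)).
  by have := cross_gt0 n.+1 (o'_lt0 i h); rewrite ro'0 // mulr0 subr0 mulrC.
exists e, o, t; split=> //.
- split; first by move=> i h; have [] := He i h; split=> //; apply: e_lt0.
    by move=> i h; have [] := Ho i h.
  split=> i; first by move=> _ h; have [] := Ho i h.
  by move=> h; have [|_ _] := Ho i; [lia|apply].
- by move=> i h; have [] := Ht i h.
- split=> i; first by move=> h1 h2; have [_ _ /(_ h2)] := Ht i h1.
  by move=> h; have [_ h1 _] := Ht _ h.
Qed.

Lemma hermite_biehler_exists n : exists e o, hermite_biehler n e o.
Proof.
elim: n => [|n [e' [o' /hermite_biehler_step[e [o [t [H _ _ _]]]]]]]; last by exists e, o.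
by exists (fun=> 0), (fun=> 0).
Qed.

Lemma interlace_E n : interlace (E n.+2) (E n.+1).
Proof.
have [e' [o' H']] := hermite_biehler_exists n.
have [e [o [t [[re _ _] alt _ _]]]] := hermite_biehler_step H'.
apply: (interlace_of_alternating (size_E n.+2) (size_E n.+1) _ _ _ alt); first lia.
- by move=> i /re[].
- by case: H' => re' _ _ i /re'[].
Qed.

Lemma interlace_O n : interlace (O n.+2) (O n.+1).
Proof.
have [e' [o' H']] := hermite_biehler_exists n.
have [e [o [t [_ _ rt alt]]]] := hermite_biehler_step H'.
apply: (interlace_of_alternating (size_O n.+1) (size_O n) _ _ _ alt) => //; first lia.
by case: H'.
Qed.

End CrossPositive.
End Interlacing.

(** * The polynomials phi *)

Section Phi.
Variable R : rcfType.
Implicit Types (a b c m x : R) (p q r : {poly R}) (n k : nat).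

(** Since s = (x - 1) / 2, each derivative in x costs a factor 1/2, so 2k of them cost 4^-k. *)
Definition quarter p : {poly R} := p \Po (4^-1 *: 'X).

Lemma coef_quarter p k : (quarter p)`_k = p`_k * 4^-1 ^+ k.
Proof.
rewrite /quarter comp_polyE.
under eq_bigr do rewrite exprZn scalerA.
rewrite -(poly_def _ (fun i => p`_i * 4^-1 ^+ i)) coef_poly; case: ltnP => // pk.
by rewrite nth_default ?mul0r.
Qed.

Lemma horner_quarter p x : (quarter p).[x] = p.[x / 4].
Proof. by rewrite horner_comp hornerZ hornerX mulrC. Qed.

Lemma poch_oppn n k : poch (- n%:R) k = (-1) ^+ k * ('C(n, k) * k`!)%:R :> R.
Proof.
rewrite bin_ffact; elim: k => [|k IH]; first by rewrite poch0 ffactn0 mul1r.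
rewrite pochSr IH ffactnSr exprS natrM; have [kn|nk] := leqP k n.
  by rewrite natrB //; ring.
by rewrite ffact_small //; ring.
Qed.

(** The sign (-1)^k in (-n)_k cancels the one in ((1 - x) / 2)^k = (-s)^k. *)
Lemma jacobiP_jac n a b :
  jacobiP n a b = (poch (a + 1) n / n`!%:R) *: (jac a b n \Po (2^-1 *: ('X - 1))).
Proof.
rewrite /jacobiP; congr (_ *: _); rewrite /jac poly_def linear_sum /=.
apply: eq_bigr => k _; rewrite linearZ /= rmorphXn /= comp_polyX.
have -> : (1 - 'X) * 2^-1%:P = (-1 : R) *: (2^-1 *: ('X - 1)) :> {poly R}.
  by rewrite -!mul_polyC polyCN polyC1; ring.
rewrite exprZn scalerA; congr (_ *: _).
have k0 : k`!%:R != 0 :> R by rewrite pnatr_eq0 -lt0n fact_gt0.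
rewrite poch_oppn natrM invfM; set e := (-1) ^+ k.
have ee : e * e = 1 by rewrite -expr2 sqrr_sign.
move: (poch (a + 1) k)^-1 k`!%:R k0 => Q K k0.
rewrite -[RHS]mul1r; transitivity (e * e * ('C(n, k)%:R * poch (n%:R + a + b + 1) k * Q)).
  by clearbody e; field.
by rewrite ee.
Qed.

Lemma derivn_comp_linear p q c k : q^`() = c%:P ->
  (p \Po q)^`(k) = c ^+ k *: (p^`(k) \Po q).
Proof.
move=> dq; elim: k => [|k IH]; first by rewrite !derivn0 scale1r.
by rewrite derivnS IH derivZ deriv_comp dq mulrC mul_polyC scalerA -exprSr derivnS.
Qed.

Lemma phi_evp n a b :
  phi n a b = (poch (a + 1) n / n`!%:R) *: quarter (evp (jac a b n)).
Proof.
rewrite /phi -(poly_def _ (fun k => ((jacobiP n a b)^`(2 * k)).[1])).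
apply/polyP => k; rewrite coefZ coef_poly coef_quarter coef_evp.
case: ltnP => [kn|nk]; last by rewrite coef_jac bin_small ?mul0r ?mul0rn ?mul0r ?mulr0 //; lia.
rewrite jacobiP_jac derivnZ hornerZ; congr (_ * _).
rewrite (derivn_comp_linear _ _ (c := 2^-1)); last first.
  by rewrite derivZ derivB derivX derivC subr0 alg_polyC.
rewrite hornerZ horner_comp !hornerE subrr mulr0 horner_coef0 coef_derivn addn0 ffactnn.
by rewrite mulrC exprM; congr (_ * _ ^+ _); field.
Qed.

Lemma size_lead_gt0 p k :
  (forall j, (k < j)%N -> p`_j = 0) -> 0 < p`_k -> size p = k.+1 /\ 0 < lead_coef p.
Proof.
move=> p0 pk; suff sp : size p = k.+1 by rewrite lead_coefE sp.
apply/eqP; rewrite eqn_leq; apply/andP; split; first by apply/leq_sizeP.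
by rewrite ltnNge; apply/negP => /leq_sizeP/(_ k (leqnn k)) E; rewrite E ltxx in pk.
Qed.

Lemma quarter_evp_size_lead_gt0 p n : (forall k, (k <= n)%N -> 0 < p`_k) -> size p = n.+1 ->
  let q := quarter (evp p) in [/\ size q = n./2.+1, 0 < lead_coef q & 0 < q.[0]].
Proof.
move=> p_gt0 sp q; have c k : (2 * k <= n)%N -> 0 < q`_k.
  move=> kn; rewrite coef_quarter coef_evp mulr_gt0 ?exprn_gt0 ?invr_gt0 ?ltr0n //.
  by rewrite pmulrn_lgt0 ?fact_gt0 // p_gt0.
have [||sq lq] := @size_lead_gt0 q n./2.
- by move=> j nj; rewrite coef_quarter coef_evp nth_default ?mul0rn ?mul0r // sp; lia.
- by apply: c; lia.
by split=> //; rewrite horner_coef0 c.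
Qed.

(** Positive coefficients give the degrees and signs needed for the induction, and m / 4 is negative
    with m, so the cross inequality survives the rescaling. *)
Lemma interlace_quarter_jac a b n : -1 < a -> -1 < b ->
  (forall n m, m < 0 -> 0 < (evp (jac a b n.+1)^`()).[m] * (evp (jac a b n)).[m]
      - (evp (jac a b n.+1)).[m] * (evp (jac a b n)^`()).[m]) ->
  interlace (quarter (evp (jac a b n.+2))) (quarter (evp (jac a b n.+1))) /\
  interlace (quarter (evp (jac a b n.+2)^`())) (quarter (evp (jac a b n.+1)^`())).
Proof.
move=> ha hb cross.
have posE k := @quarter_evp_size_lead_gt0 (jac a b k) k
  (fun j => @coef_jac_gt0 _ a b k j ha hb) (size_jac k ha hb).
have posO k : let q := quarter (evp (jac a b k.+1)^`()) in
    [/\ size q = k./2.+1, 0 < lead_coef q & 0 < q.[0]].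
  have h j : (j <= k)%N -> 0 < ((jac a b k.+1)^`())`_j.
    by move=> jk; rewrite coef_deriv pmulrn_lgt0 // coef_jac_gt0.
  apply: quarter_evp_size_lead_gt0 => //.
  have [//|-> //] := @size_lead_gt0 (jac a b k.+1)^`() k _ (h k (leqnn k)).
  by move=> j kj; rewrite coef_deriv nth_default ?mul0rn // size_jac.
have crossq k m : m < 0 ->
    0 < (quarter (evp (jac a b k.+1)^`())).[m] * (quarter (evp (jac a b k))).[m]
    - (quarter (evp (jac a b k.+1))).[m] * (quarter (evp (jac a b k)^`())).[m].
  by move=> m0; rewrite !horner_quarter cross // pmulr_llt0 // invr_gt0.
pose E k := quarter (evp (jac a b k)); pose O k := quarter (evp (jac a b k)^`()).
have sE k : size (E k) = k./2.+1 by case: (posE k).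
have lE k : 0 < lead_coef (E k) by case: (posE k).
have E0 k : 0 < (E k).[0] by case: (posE k).
have sO k : size (O k.+1) = k./2.+1 by case: (posO k).
have lO k : 0 < lead_coef (O k.+1) by case: (posO k).
have O0 k : 0 < (O k.+1).[0] by case: (posO k).
by split; [apply: (@interlace_E _ E O) | apply: (@interlace_O _ E O)].
Qed.

End Phi.

Theorem mainTheorem4 (R : rcfType) (n : nat) (al be : R) :
  (4 <= n)%N ->
  [\/ (-1 < al < 0) && (-1 < be),
      (0 <= al < 1) && (0 < be) |
      (1 <= al < 2) && (1 < be)] ->
  interlace (phi n al be) (phi n.-1 al be).
Proof.
case: n => [|[|n]] // _ hab.
have al1 : -1 < al by case: hab => /andP[/andP[? ?] ?]; lra.
have c0 k : poch (al + 1) k / k`!%:R != 0 :> R.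
  by rewrite gt_eqF // divr_gt0 ?ltr0n ?fact_gt0 // poch_gt0 //; lra.
rewrite !phi_evp; apply: interlaceZ => //.
case: hab => /andP[/andP[h1 h2] h3].
- apply: (interlace_quarter_jac n _ _ _).1 => // k m; apply: jac_cross_gt0_neg => //.
  by rewrite h1.
- apply: (interlace_quarter_jac n _ _ _).1; [lra|lra|move=> k m; apply: jac_cross_gt0 => //].
  by rewrite h2 al1.
pose a := al - 1; pose b := be - 1.
have a1 : -1 < a by rewrite /a; lra.
have b0 : 0 < b by rewrite /b; lra.
(* With both parameters lowered by one, the degree k polynomial is a multiple of the odd part in
   degree k + 1; hence the interlacing of odd parts is used at [n.+1]. *)
have E k : exists2 c : R, c != 0 &
    quarter (evp (jac al be k)) = c *: quarter (evp (jac a b k.+1)^`()).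
  have k0 : 0 <= k%:R :> R := ler0n _ k.
  set d := k.+1%:R * (k.+1%:R + a + b + 1) / (a + 1).
  have d0 : d != 0.
    by rewrite gt_eqF // divr_gt0 ?mulr_gt0 ?ltr0n // -?natr1; lra.
  exists d^-1; first by rewrite invr_eq0.
  rewrite deriv_jac // -/d linearZ /= /quarter comp_polyZ scalerA mulVf // scale1r.
  by rewrite /a /b !subrK.
have [c2 c2_neq0 ->] := E n.+2; have [c1 c1_neq0 ->] := E n.+1.
apply: interlaceZ => //; apply: (interlace_quarter_jac n.+1 _ _ _).2 => //; first lra.
move=> k m; apply: jac_cross_gt0 => //; rewrite a1 /a; lra.
Qed.
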